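(* Let $\mathbb F_2$ be the free group of rank $2$ and let $S$ be a finite generating set of $\mathbb F_2$. There exists a faithful sequence of irreducible symmetric representations $(\sigma_n:\mathbb F_2\to\mathrm{Sym}(X_n))_n$ of $\mathbb F_2$ such that the coarse disjoint union $\sqcup_n\mathrm{Sch}_S(X_n)$ of the associated Schreier graphs has property (A).
   Context: Symmetric representations: an irreducible symmetric representation of a group $G$ is the homomorphism $G\to\mathrm{Sym}(G/N)$ given by the left action of $G$ on $X=G/N$, where $N\le G$ is a finite index, not necessarily normal, subgroup. A sequence of such representations, given by finite index subgroups $(N_n)_n$, is faithful if the subgroups $N_n$ have trivial intersection. The Schreier graph $\mathrm{Sch}_S(X)$ has vertex set $X$ and an edge joining $z$ to $s.z$ for each $z\in X$, $s\in S$; it carries the graph metric. Coarse disjoint union: let $d_{\mathrm{f.a}}(n,m)=|2^n-2^m|$ on $\mathbb N$. The coarse disjoint union $\sqcup_nX_n$ of a sequence of metric spaces is the metric space $(X,d)$, unique up to coarse equivalence, such that: (1) there are a map $p:X\to\mathbb N$ and a non-decreasing function $\rho:[0,\infty)\to[0,\infty)$ tending to infinity such that $p^{-1}(n)$ is isometric to $X_n$ for all $n$ and $d_{\mathrm{f.a}}(p(x),p(y))\le\rho(d(x,y))$ for all $x,y$; (2) for all $R>0$ and $n\ne m$, $\{x\in X_n: d(x,X_m)\le R\}$ is bounded. Property (A): a discrete metric space $(X,d)$ with bounded geometry has property (A) if for every $R>0$ and $\varepsilon>0$ there exist $M>0$ and $\phi:X\to\ell^2(X)$ with $\|\phi(x)\|=1$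 for all $x$ such that $|1-\langle\phi(x_1),\phi(x_2)\rangle|\le\varepsilon$ whenever $d(x_1,x_2)\le R$, and $\phi(x)$ is supported in the ball $B_M(x)$ for every $x\in X$. *)

(* Defs.v *)
From HB Require Import structures.
From mathcomp Require Import all_boot all_order all_algebra.
From mathcomp Require Import all_classical all_reals all_analysis.
From mathcomp Require Import complex.
From mathcomp Require Import lra.

Set Implicit Arguments.
Unset Strict Implicit.
Unset Printing Implicit Defensive.

Import Order.TTheory GRing.Theory Num.Theory.

Local Open Scope classical_set_scope.
Local Open Scope ring_scope.

Section FreeGroup.
Variable n : nat.

(* (i, false) is the i-th generator and (i, true) its inverse. *)
Definition letter : Type := ('I_n * bool)%type.
HB.instance Definition _ := Choice.on letter.
Implicit Types (x y : letter) (u v w : seq letter).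

Definition letter_inv x : letter := (x.1, ~~ x.2).

Fixpoint reduced w : bool :=
  if w is x :: v then
    (if v is y :: _ then y != letter_inv x else true) && reduced v
  else true.

Definition push x w : seq letter :=
  if w is y :: v then if y == letter_inv x then v else x :: w else [:: x].

Record free_group : Type :=
  FreeWord { free_word :> seq letter; _ : reduced free_word }.
HB.instance Definition _ := [isSub for free_word].
HB.instance Definition _ := [Choice of free_group by <:].

Lemma letter_invK : involutive letter_inv.
Proof. by case=> i b; rewrite /letter_inv /= negbK. Qed.

Lemma letter_inv_neq x : x != letter_inv x.
Proof. by case: x => i [] ; rewrite /letter_inv -pair_eqE /= andbF. Qed.

Lemma reduced_behead x w : reduced (x :: w) -> reduced w.
Proof. by move=> /andP[]. Qed.

Lemma reduced_push x w : reduced w -> reduced (push x w).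
Proof.
case: w => [//|y v] rw /=; case: eqP => [_|/eqP yx].
  exact: reduced_behead rw.
by rewrite /= yx; exact: rw.
Qed.

Lemma reduced_foldr u w : reduced w -> reduced (foldr push w u).
Proof. by move=> rw; elim: u => //= x u; exact: reduced_push. Qed.

Lemma push_inv x w : reduced w -> push x (push (letter_inv x) w) = w.
Proof.
case: w => [_|y v rw] /=; first by rewrite eqxx.
rewrite letter_invK; case: eqP => [yx|yx] /=; last by rewrite eqxx.
case: v rw => [|z v] /=; first by rewrite yx.
by move=> /andP[zy _]; rewrite -yx (negbTE zy).
Qed.

Lemma push_invl x w : reduced w -> push (letter_inv x) (push x w) = w.
Proof. by move=> rw; rewrite -{2}(letter_invK x) push_inv. Qed.

Lemma foldr_push_push x t w : reduced w ->
  foldr push w (push x t) = push x (foldr push w t).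
Proof.
case: t => [//|y t] rw /=; case: eqP => // ->.
by rewrite push_inv// reduced_foldr.
Qed.

Lemma foldr_pushA u v w : reduced w ->
  foldr push (foldr push w v) u = foldr push w (foldr push v u).
Proof. by move=> rw; elim: u => //= x u ->; rewrite foldr_push_push. Qed.

Lemma foldr_push_nil w : reduced w -> foldr push [::] w = w.
Proof.
elim: w => //= x w IH /andP[xw rw]; rewrite (IH rw).
by case: w xw {IH rw} => [//|y v] /= /negbTE ->.
Qed.

Lemma foldr_push_rcons x u w : reduced w ->
  foldr push w (rcons u x) = foldr push (push x w) u.
Proof. by elim: u => //= y u IH rw; rewrite IH. Qed.

Definition word_inv w : seq letter := rev (map letter_inv w).

Lemma reduced_rcons y w : reduced w ->
  (w = [::] \/ last y w != letter_inv y) -> reduced (rcons w y).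
Proof.
elim: w => //= x w IH /andP[xw rw] [//|H].
case: w IH xw rw H => [|z w] IH xw rw H /=.
  by rewrite andbT; apply: contra_neq H => ->; rewrite letter_invK.
rewrite /= in xw; rewrite xw /=; apply: IH => //; by right.
Qed.

Lemma reduced_word_inv w : reduced w -> reduced (word_inv w).
Proof.
rewrite /word_inv; elim: w => //= x w IH /andP[xw /IH rw].
rewrite rev_cons; apply: reduced_rcons => //.
case: w {IH rw} xw => [|y w] /= xw; first by left.
right; rewrite rev_cons last_rcons letter_invK.
by apply: contra_neq xw => <-; rewrite letter_invK.
Qed.

Lemma foldr_push_inv w u : reduced u ->
  foldr push (foldr push u w) (word_inv w) = u.
Proof.
rewrite /word_inv; elim: w u => //= x w IH u ru.
rewrite rev_cons foldr_push_rcons ?push_invl ?IH//; first exact: reduced_foldr.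
exact/reduced_push/reduced_foldr.
Qed.

Lemma free_wordP (g : free_group) : reduced g. Proof. exact: valP g. Qed.

Definition free_one : free_group := @FreeWord [::] isT.
Definition free_mul (g h : free_group) : free_group :=
  FreeWord (reduced_foldr g (free_wordP h)).
Definition free_inv (g : free_group) : free_group :=
  FreeWord (reduced_word_inv (free_wordP g)).

Let free_mulA : associative free_mul.
Proof. by move=> g h k; apply: val_inj; rewrite /= foldr_pushA// free_wordP. Qed.
Let free_mul1g : left_id free_one free_mul.
Proof. by move=> g; apply: val_inj. Qed.
Let free_mulg1 : right_id free_one free_mul.
Proof. by move=> g; apply: val_inj; rewrite /= foldr_push_nil// free_wordP. Qed.
Let free_mulVg : left_inverse free_one free_inv free_mul.
Proof.
move=> g; apply: val_inj => /=.
by rewrite -[in X in foldr _ X](foldr_push_nil (free_wordP g)) foldr_push_inv.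
Qed.
Let free_mulgV : right_inverse free_one free_inv free_mul.
Proof.
move=> g; rewrite -[LHS]free_mul1g -(free_mulVg (free_inv g)).
by rewrite -free_mulA (free_mulA (free_inv g)) free_mulVg free_mul1g.
Qed.

HB.instance Definition _ := isGroup.Build free_group
  free_mulA free_mul1g free_mulg1 free_mulVg free_mulgV.

Definition free_gen (i : 'I_n) : free_group := @FreeWord [:: (i, false)] isT.

End FreeGroup.

Notation F2 := (free_group 2).

(* The universal property, as a check on the construction. *)
Section FreeGroupUniversal.
Variables (n : nat) (H : groupType) (h : 'I_n -> H).
Local Open Scope group_scope.

Let ev (x : letter n) : H := if x.2 then (h x.1)^-1 else h x.1.

Definition free_lift (g : free_group n) : H :=
  foldr (fun x a => ev x * a) 1 (free_word g).

Let evV x : ev (letter_inv x) = (ev x)^-1.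
Proof. by case: x => i [] /=; rewrite /ev /= ?invgK. Qed.

Let evS u := foldr (fun x a => ev x * a) 1 u.

Let evS_push x u : evS (push x u) = ev x * evS u.
Proof.
case: u => [//|y u] /=; case: eqP => [->|//]; rewrite evV mulgA.
by rewrite mulgV mul1g.
Qed.

Lemma free_liftM : {morph free_lift : a b / a * b}.
Proof.
move=> a b; rewrite /free_lift /= -!/(evS _).
elim: (free_word a) => [|x u IH] /=; first by rewrite mul1g.
by rewrite evS_push IH mulgA.
Qed.

Lemma free_lift_gen i : free_lift (free_gen i) = h i.
Proof. by rewrite /free_lift /= mulg1. Qed.

Lemma free_lift_unique (f : free_group n -> H) :
  {morph f : a b / a * b} -> (forall i, f (free_gen i) = h i) -> f =1 free_lift.
Proof.
move=> fM fg; have f1 : f 1 = 1.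
  by apply: (mulIg (f 1)); rewrite -fM !mul1g.
have fx x : f (@FreeWord n [:: x] isT) = ev x.
  case: x => i []; rewrite /ev /= -fg //.
  apply: (mulIg (f (free_gen i))); rewrite -fM mulVg.
  by rewrite -f1; congr f; apply: val_inj; rewrite /= eqxx.
case=> w; rewrite /free_lift /=; elim: w => [|x w IH] rw.
  by rewrite -[RHS]f1; congr f; apply: val_inj.
have rw' := reduced_behead rw.
rewrite /= -(IH rw') -fx -fM; congr f; apply: val_inj => /=.
by case: w rw {IH rw'} => [//|y w] /= /andP[/negbTE -> _].
Qed.

End FreeGroupUniversal.

Section Sym.
Variable X : Type.

Record Sym : Type := MkSym {
  sym_fun :> X -> X;
  sym_inv : X -> X;
  sym_funK : cancel sym_fun sym_inv;
  sym_invK : cancel sym_inv sym_fun }.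

Lemma symP (s t : Sym) : s =1 t -> s = t.
Proof.
case: s t => [f f' fK f'K] [g g' gK g'K] /= /funext fg.
move: gK g'K; rewrite -{}fg => gK g'K.
have e : f' = g' by apply/funext => x; rewrite -{1}(g'K x) fK.
move: gK g'K; rewrite -{}e => gK g'K.
by congr MkSym; exact: Prop_irrelevance.
Qed.

HB.instance Definition _ := gen_eqMixin Sym.
HB.instance Definition _ := gen_choiceMixin Sym.

Definition sym_one : Sym := @MkSym id id (fun=> erefl) (fun=> erefl).
Definition sym_mul (s t : Sym) : Sym :=
  MkSym (can_comp (@sym_funK s) (@sym_funK t))
        (can_comp (@sym_invK t) (@sym_invK s)).
Definition sym_V (s : Sym) : Sym := MkSym (@sym_invK s) (@sym_funK s).

Let sym_mulA : associative sym_mul. Proof. by move=> ? ? ?; apply/symP. Qed.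
Let sym_mul1g : left_id sym_one sym_mul. Proof. by move=> ?; apply/symP. Qed.
Let sym_mulg1 : right_id sym_one sym_mul. Proof. by move=> ?; apply/symP. Qed.
Let sym_mulVg : left_inverse sym_one sym_V sym_mul.
Proof. by move=> s; apply/symP => x /=; rewrite sym_funK. Qed.
Let sym_mulgV : right_inverse sym_one sym_V sym_mul.
Proof. by move=> s; apply/symP => x /=; rewrite sym_invK. Qed.

HB.instance Definition _ := isGroup.Build Sym
  sym_mulA sym_mul1g sym_mulg1 sym_mulVg sym_mulgV.

End Sym.

Section Subgroups.
Variable G : groupType.
Local Open Scope group_scope.

Definition subgroup_of (A : set G) (A1 : A 1)
    (AM : forall x y, A x -> A y -> A (x * y))
    (AV : forall x, A x -> A x^-1) : groupClosed G :=
  let S : {pred G} := fun x => `[< A x >] in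
  let m1 := @isMul1Closed.Build G S (asboolT A1) in
  let mM := @isMulClosed.Build G S (fun x y Sx Sy =>
    asboolT (AM x y (asboolW Sx) (asboolW Sy))) in
  let mV := @isInvClosed.Build G S (fun x Sx => asboolT (AV x (asboolW Sx))) in
  HB.pack S m1 mM mV.

Lemma subgroup_ofE A A1 AM AV x :
  (x \in @subgroup_of A A1 AM AV) <-> A x.
Proof. by rewrite unfold_in; split=> [/asboolW|/asboolT]. Qed.

Definition generates (S : set G) : Prop :=
  forall H : groupClosed G, (forall s, S s -> s \in H) -> forall x, x \in H.

Section Cosets.
Variable N : groupClosed G.
Local Open Scope quotient_scope.

(* x and y are in the same left coset of N, i.e. x N = y N. *)
Definition lcoset_eq (x y : G) : bool := x^-1 * y \in N.

Let lcoset_eq_refl : reflexive lcoset_eq.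
Proof. by move=> x; rewrite /lcoset_eq mulVg gpred1. Qed.
Let lcoset_eq_sym : symmetric lcoset_eq.
Proof. by move=> x y; rewrite /lcoset_eq -gpredV invgM invgK. Qed.
Let lcoset_eq_trans : transitive lcoset_eq.
Proof.
move=> y x z xy yz; rewrite /lcoset_eq.
by rewrite -[z](mulVKg y) mulgA gpredM.
Qed.

Canonical lcoset_equiv :=
  EquivRel lcoset_eq lcoset_eq_refl lcoset_eq_sym lcoset_eq_trans.

Definition cosets : Type := {eq_quot lcoset_equiv}.
HB.instance Definition _ := Choice.on cosets.

Definition coset_of_elt (x : G) : cosets := \pi_({eq_quot lcoset_equiv}) x.

Lemma coset_of_eltP x y : coset_of_elt x = coset_of_elt y <-> x^-1 * y \in N.
Proof.
rewrite /coset_of_elt; split=> [/eqP|h]; first by rewrite eqmodE.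
by apply/eqP; rewrite eqmodE.
Qed.

Definition coset_repr (z : cosets) : G :=
  repr (z : {eq_quot lcoset_equiv} : quotType G).

Lemma coset_reprK : cancel coset_repr coset_of_elt.
Proof. by move=> z; rewrite /coset_of_elt /coset_repr reprK. Qed.

Definition coset_act (g : G) (z : cosets) : cosets :=
  coset_of_elt (g * coset_repr z).

Lemma coset_actE g x : coset_act g (coset_of_elt x) = coset_of_elt (g * x).
Proof.
apply/coset_of_eltP; rewrite invgM mulgA mulgVK.
by apply/coset_of_eltP; exact: coset_reprK.
Qed.

Let coset_actM g h z : coset_act (g * h) z = coset_act g (coset_act h z).
Proof. by rewrite -(coset_reprK z) !coset_actE mulgA. Qed.
Let coset_act1 z : coset_act 1 z = z.
Proof. by rewrite -(coset_reprK z) coset_actE mul1g. Qed.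
Let coset_actK g : cancel (coset_act g) (coset_act g^-1).
Proof. by move=> z; rewrite -coset_actM mulVg coset_act1. Qed.
Let coset_actVK g : cancel (coset_act g^-1) (coset_act g).
Proof. by move=> z; rewrite -coset_actM mulgV coset_act1. Qed.

Definition coset_rep (g : G) : Sym cosets :=
  MkSym (@coset_actK g) (@coset_actVK g).

Let coset_repM : {morph coset_rep : g h / g * h}.
Proof. by move=> g h; apply/symP => z; exact: coset_actM. Qed.
Let coset_rep1 : coset_rep 1 = 1.
Proof. by apply/symP => z; exact: coset_act1. Qed.
HB.instance Definition _ :=
  isMultiplicative.Build G (Sym cosets) coset_rep coset_repM.
HB.instance Definition _ :=
  Multiplicative_isUMagmaMorphism.Build G (Sym cosets) coset_rep coset_rep1.

Lemma coset_repE g x : coset_rep g (coset_of_elt x) = coset_of_elt (g * x).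
Proof. exact: coset_actE. Qed.

End Cosets.

(* An irreducible symmetric representation is determined by the subgroup N. *)
Record irr_symrep : Type := IrrSymRep {
  symrep_subgroup : groupClosed G;
  symrep_finite_index : finite_set [set: cosets symrep_subgroup] }.

Definition symrep_space (s : irr_symrep) : Type := cosets (symrep_subgroup s).
HB.instance Definition _ s := Choice.on (symrep_space s).

Definition symrep_hom (s : irr_symrep) :
    UMagmaMorphism.type G (Sym (symrep_space s)) :=
  coset_rep (symrep_subgroup s).

Definition faithful_sequence (s : nat -> irr_symrep) : Prop :=
  \bigcap_n [set g | g \in symrep_subgroup (s n)] = [set 1].

End Subgroups.

Fixpoint walk (T : Type) (e : T -> T -> Prop) (n : nat) (x y : T) : Prop :=
  if n is k.+1 then exists2 z, e x z & walk e k z y else x = y.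

Lemma walk_cat (T : Type) (e : T -> T -> Prop) m n x y z :
  walk e m x y -> walk e n y z -> walk e (m + n) x z.
Proof.
elim: m x => [x /= ->|m IH x /= [t xt ty] yz]; first by rewrite add0n.
by exists t => //; exact: IH.
Qed.

Lemma walk_sym (T : Type) (e : T -> T -> Prop) n x y :
  (forall a b, e a b -> e b a) -> walk e n x y -> walk e n y x.
Proof.
move=> es; elim: n x => [//|n IH] x [t xt /IH ty].
by rewrite -(addn1 n); apply: walk_cat ty _; exists x => //; exact: es.
Qed.

(* Loops are allowed; they do not affect the graph metric. *)
Record connected_graph : Type := ConnectedGraph {
  vertex : choiceType;
  adj : vertex -> vertex -> Prop;
  adj_sym : forall x y, adj x y -> adj y x;
  adj_connected : forall x y, exists n, walk adj n x y }.

(* R, the field where the metric takes its values, is a phantom parameter. *)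
Definition graph_space (R : realType) (Gamma : connected_graph) : Type :=
  vertex Gamma.
HB.instance Definition _ R Gamma := Choice.on (graph_space R Gamma).

Section GraphMetric.
Variables (R : realType) (Gamma : connected_graph).

Let walk_ex (x y : vertex Gamma) : exists n, `[< walk (@adj Gamma) n x y >].
Proof. by have [n w] := adj_connected x y; exists n; apply/asboolP. Qed.

Definition graph_dist (x y : vertex Gamma) : nat := ex_minn (walk_ex x y).

Lemma graph_distP x y :
  walk (@adj Gamma) (graph_dist x y) x y /\
  forall n, walk (@adj Gamma) n x y -> (graph_dist x y <= n)%N.
Proof.
rewrite /graph_dist; case: ex_minnP => m /asboolP wm lem; split => // n wn.
by apply: lem; apply/asboolP.
Qed.

Local Notation graph_space := (graph_space R Gamma).

Let gd (x y : graph_space) : R := (graph_dist x y)%:R.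

Let gdxx x : gd x x = 0.
Proof.
have [_ /(_ 0%N erefl)] := graph_distP x x.
by rewrite leqn0 /gd => /eqP ->.
Qed.
Let gd_eq0 x y : gd x y = 0 -> x = y.
Proof.
move=> /eqP; rewrite /gd pnatr_eq0 => /eqP d0.
by have [] := graph_distP x y; rewrite d0.
Qed.
Let gd_le x y : (graph_dist x y <= graph_dist y x)%N.
Proof.
have [w _] := graph_distP y x; have [_] := graph_distP x y; apply.
by apply: walk_sym w; exact: adj_sym.
Qed.
Let gd_sym x y : gd x y = gd y x.
Proof. by congr (_%:R); apply/eqP; rewrite eqn_leq !gd_le. Qed.
Let gd_triangle y x z : gd x z <= gd x y + gd y z.
Proof.
rewrite /gd -natrD ler_nat; have [_] := graph_distP x z; apply.
exact: walk_cat (graph_distP x y).1 (graph_distP y z).1.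
Qed.

HB.instance Definition _ :=
  isMetric.Build R graph_space gdxx gd_eq0 gd_sym gd_triangle.

Lemma graph_mdistE (x y : graph_space) : mdist x y = (graph_dist x y)%:R :> R.
Proof. by []. Qed.

End GraphMetric.

Section Schreier.
Variables (G : groupType) (S : set G) (genS : generates S) (s : irr_symrep G).
Local Open Scope group_scope.

Let X : choiceType := symrep_space s.

Definition schreier_adj (x y : X) : Prop :=
  exists2 g, S g & (y = symrep_hom s g x \/ x = symrep_hom s g y).

Let schreier_sym x y : schreier_adj x y -> schreier_adj y x.
Proof. by case=> g Sg [->|->]; exists g => //; [right|left]. Qed.

Let schreier_connected x y : exists n, walk schreier_adj n x y.
Proof.
pose A : set G := fun g => forall z, exists n, walk schreier_adj n z (symrep_hom s g z).
have A1 : A 1 by move=> z; exists 0%N; rewrite gmulf1.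
have AM g h : A g -> A h -> A (g * h).
  move=> Ag Ah z; have [m wm] := Ah z; have [n wn] := Ag (symrep_hom s h z).
  by exists (m + n)%N; apply: walk_cat wm _; rewrite gmulfM.
have AV g : A g -> A g^-1.
  move=> Ag z; have [n wn] := Ag (symrep_hom s g^-1 z).
  exists n; apply: walk_sym => //.
  have e : symrep_hom s g (symrep_hom s g^-1 z) = z.
    by rewrite -[LHS]/((symrep_hom s g * symrep_hom s g^-1) z)
       -gmulfM mulgV gmulf1.
  by rewrite e in wn.
have Ag g : A g.
  apply/(subgroup_ofE A1 AM AV); apply: genS => h Sh.
  apply/subgroup_ofE => z; exists 1%N; exists (symrep_hom s h z) => //.
  by exists h => //; left.
pose a := coset_repr x; pose b := coset_repr y.
have [n] := Ag (b * a^-1) x; exists n.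
suff <- : symrep_hom s (b * a^-1) x = y by [].
by rewrite -[x]coset_reprK coset_repE -/a mulgVK /b coset_reprK.
Qed.

Definition schreier : connected_graph :=
  ConnectedGraph schreier_sym schreier_connected.

End Schreier.

Section CoarseDisjointUnion.
Variable R : realType.

Definition d_fa (n m : nat) : R := `|2 ^+ n - 2 ^+ m|.

Definition metric_bounded (X : metricType R) (A : set X) : Prop :=
  exists C : R, forall x y, A x -> A y -> mdist x y <= C.

(* The distance to the empty set is +oo. *)
Definition dist_set (X : metricType R) (x : X) (A : set X) : \bar R :=
  ereal_inf [set (mdist x y)%:E | y in A].

Definition isometric_to_subset (Y X : metricType R) (A : set X) : Prop :=
  exists2 i : Y -> X, (forall y z, mdist (i y) (i z) = mdist y z) & range i = A.

(* The coarse disjoint union is determined only up to coarse equivalence, hence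
   a predicate on X. Only the values of rho on [0, +oo[ matter. *)
Definition is_coarse_disjoint_union (Xn : nat -> metricType R)
    (X : metricType R) : Prop :=
  exists (p : X -> nat) (rho : R -> R),
    [/\ [/\ forall t, 0 <= t -> 0 <= rho t,
            forall t u, 0 <= t -> t <= u -> rho t <= rho u
          & rho t @[t --> +oo] --> +oo],
        forall n, isometric_to_subset (Xn n) (p @^-1` [set n]),
        forall x y, d_fa (p x) (p y) <= rho (mdist x y)
      & forall (r : R) (n m : nat), 0 < r -> n <> m ->
          metric_bounded
            [set x | p x = n /\ (dist_set x (p @^-1` [set m]) <= r%:E)%E] ].

End CoarseDisjointUnion.

(* Coarse disjoint unions of nonempty metric spaces exist: glue the X_n at base
   points b n placed at mutual distance d_fa. *)
Definition cdu_space (R : realType) (Xn : nat -> metricType R)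
  (b : forall n, Xn n) : Type := {n : nat & Xn n}.
HB.instance Definition _ R Xn b := gen_eqMixin (@cdu_space R Xn b).
HB.instance Definition _ R Xn b := gen_choiceMixin (@cdu_space R Xn b).

Section CoarseDisjointUnionExists.
Variables (R : realType) (Xn : nat -> metricType R) (b : forall n, Xn n).
Local Notation cdu_space := (cdu_space b).

Let du (u v : cdu_space) : R :=
  if tag u == tag v then mdist (tagged u) (tagged_as u v)
  else mdist (tagged u) (b (tag u)) + mdist (tagged v) (b (tag v))
       + d_fa R (tag u) (tag v).

Let du_same n (x y : Xn n) : du (Tagged Xn x) (Tagged Xn y) = mdist x y.
Proof. by rewrite /du /= eqxx tagged_asE. Qed.
Let du_diff n m (x : Xn n) (y : Xn m) : n != m ->
  du (Tagged Xn x) (Tagged Xn y) = mdist x (b n) + mdist y (b m) + d_fa R n m.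
Proof. by rewrite /du /= => /negbTE ->. Qed.

Let d_faC n m : d_fa R n m = d_fa R m n. Proof. exact: distrC. Qed.
Let d_fa_ge0 n m : 0 <= d_fa R n m. Proof. exact: normr_ge0. Qed.
Let d_fa_gt0 n m : n != m -> 0 < d_fa R n m.
Proof.
move=> nm; rewrite normr_gt0 subr_eq0; apply: contra_neq nm.
by apply: ieexprIn; rewrite ?ltr0n// -[1]/(1%:R) eqr_nat.
Qed.

Let duxx u : du u u = 0.
Proof. by case: u => n x; rewrite du_same mdistxx. Qed.
Let du_eq0 u v : du u v = 0 -> u = v.
Proof.
case: u v => [n x] [m y]; have [nm|nm] := eqVneq n m.
  by move: y; rewrite -nm => y; rewrite du_same => /mdist_positivity ->.
rewrite du_diff// => /eqP; rewrite gt_eqF// ltr_wpDl ?d_fa_gt0//.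
by rewrite addr_ge0 ?mdist_ge0.
Qed.
Let du_sym u v : du u v = du v u.
Proof.
case: u v => [n x] [m y]; have [nm|nm] := eqVneq n m.
  by move: y; rewrite -nm => y; rewrite !du_same metric_sym.
rewrite (du_diff _ _ nm) (du_diff _ _ (n:=m)); last by rewrite eq_sym.
by rewrite d_faC (addrC (mdist x _)).
Qed.
Let du_triangle v u w : du u w <= du u v + du v w.
Proof.
case: u v w => [n x] [m y] [k z].
have d0 := @mdist_ge0; have t := @metric_triangle.
have f0 := d_fa_ge0.
have [nk|nk] := eqVneq n k; have [nm|nm] := eqVneq n m.
- by move: y z; rewrite -nk -nm => y z; rewrite !du_same; exact: metric_triangle.
- have mn : m != n by rewrite eq_sym.
  move: z; rewrite -nk => z; rewrite du_same (du_diff _ _ nm) (du_diff _ _ mn).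
  have := t R (Xn n) x (b n) z; rewrite (metric_sym (b n) z).
  have := d0 R _ y (b m); have := f0 n m; have := f0 m n; lra.
- move: y; rewrite -nm => y; rewrite du_same !(du_diff _ _ nk).
  have := t R (Xn n) x y (b n); lra.
have [mk|mk] := eqVneq m k.
  move: z nk; rewrite -mk => z _; rewrite du_same !(du_diff _ _ nm).
  have := t R (Xn m) z y (b m); rewrite (metric_sym z y); lra.
rewrite (du_diff _ _ nk) (du_diff _ _ nm) (du_diff _ _ mk).
have := d0 R _ y (b m).
have : d_fa R n k <= d_fa R n m + d_fa R m k by exact: ler_distD.
lra.
Qed.

HB.instance Definition _ :=
  isMetric.Build R cdu_space duxx du_eq0 du_sym du_triangle.

Lemma cdu_spaceP : is_coarse_disjoint_union Xn cdu_space.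
Proof.
exists (fun u : cdu_space => tag u), id; split.
- by split => //; exact: cvg_id.
- move=> n; exists (fun x => Tagged Xn x : cdu_space).
    by move=> y z; exact: du_same.
  apply/seteqP; split => [_ [x _ <-]//|[m x] /= mn].
  by move: x; rewrite mn => x; exists x.
- move=> [n x] [m y] /=; have [nm|nm] := eqVneq n m.
    by rewrite {1}nm /d_fa subrr normr0 mdist_ge0.
  by rewrite [leRHS]du_diff// lerDr addr_ge0 ?mdist_ge0.
move=> r n m _ /eqP nm; exists (r + r).
have near x : (dist_set (Tagged Xn x : cdu_space)
    [set u : cdu_space | tag u = m] <= r%:E)%E -> mdist x (b n) <= r.
  rewrite -lee_fin; apply: le_trans; apply: le_ereal_inf_tmp => _ [[k y] /= km <-].
  move: y; rewrite km => y; rewrite lee_fin [leRHS]du_diff//.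
  by rewrite -addrA lerDl addr_ge0 ?mdist_ge0.
move=> [k x] [l y] /= [kn]; move: x; rewrite kn => x /near xr.
move=> [ln]; move: y; rewrite ln => y /near yr.
rewrite [leLHS]du_same (le_trans (metric_triangle x (b n) y))//.
by rewrite lerD// metric_sym.
Qed.

End CoarseDisjointUnionExists.

Section PropertyA.
Variables (R : realType) (X : metricType R).

Definition bounded_geometry : Prop :=
  forall r : R, 0 < r -> exists C : nat,
    forall x : X, ([set y : X | mdist x y <= r] #<= `I_C)%card.

Definition discrete_metric : Prop := forall x : X, open [set x].

Definition square_summable (f : X -> R[i]) : Prop :=
  (\esum_(x in [set: X]) ((Normc.normc (f x)) ^+ 2)%:E < +oo)%E.

Record ell2 : Type := Ell2 {
  ell2_fun :> X -> R[i];
  ell2P : square_summable ell2_fun }.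

(* Unordered sums, meaningful for absolutely summable families;
   \esum alone only handles nonnegative terms. *)
Definition real_sum (u : X -> R) : R :=
  fine (\esum_(x in [set: X]) (Num.max (u x) 0)%:E)
  - fine (\esum_(x in [set: X]) (Num.max (- u x) 0)%:E).

Definition complex_sum (u : X -> R[i]) : R[i] :=
  Complex (real_sum (fun x => complex.Re (u x)))
          (real_sum (fun x => complex.Im (u x))).

Definition ell2_dot (f g : ell2) : R[i] :=
  complex_sum (fun x => f x * conjc (g x)).

Definition ell2_norm (f : ell2) : R :=
  Num.sqrt (fine (\esum_(x in [set: X]) ((Normc.normc (f x)) ^+ 2)%:E)).

Definition property_A : Prop :=
  [/\ discrete_metric, bounded_geometry
    & forall r e : R, 0 < r -> 0 < e ->
      exists (M : R) (phi : X -> ell2),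
        [/\ 0 < M,
            forall x, ell2_norm (phi x) = 1,
            forall x1 x2, mdist x1 x2 <= r ->
              Normc.normc (1 - ell2_dot (phi x1) (phi x2)) <= e
          & forall x y, phi x y != 0 -> ball x M y] ].

End PropertyA.

(* Main.v *)
Require Import Defs.
From HB Require Import structures.
From mathcomp Require Import all_boot all_order all_algebra.
From mathcomp Require Import all_classical all_reals all_analysis.
From mathcomp Require Import complex.
From mathcomp Require Import zify lra.

(* The free group on a_1, ..., a_n embeds into the free product W of n + 1
   copies of Z/2, with generators y, x_1, ..., x_n, by a_i |-> x_i y. A word of
   length L in these involutions without two equal consecutive letters labels
   the edges of the path {0, ..., L}, and W acts on this path: each generator
   exchanges the endpoints of the edges carrying its label. The word moves L to
   0, so the stabilizers N of 0, over all such words, intersect trivially in the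
   free group. When n > 1 every vertex i misses some label d, so if the edge
   from i to i + 1 is labelled c, then c d, which lies in the free group, maps
   i to i + 1. Hence the action of the free group is transitive and its Schreier
   graphs are bilipschitz to the intervals {0, ..., L}, with constants that do
   not depend on L. For the union, normalized indicators of blocks of a fixed
   length witness property (A) far out; the finitely many levels that an
   R-ball can mix with other levels are all sent to one point mass. *)

Set Implicit Arguments.
Unset Strict Implicit.
Unset Printing Implicit Defensive.

Import Order.TTheory GRing.Theory Num.Theory.

Local Open Scope classical_set_scope.
Local Open Scope ring_scope.

(** * Words in involutions *)

Section InvolutionWords.
Variables (n : nat).
Local Open Scope nat_scope.
Implicit Types (c d : option 'I_n) (u v w : seq (option 'I_n)).

(** The letter [None] stands for $y$ and [Some i] for $x_i$; these words are the normal forms in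
    $W$. *)
Definition path_word w : bool := sorted (fun c d => c != d) w.

Definition involution_word (g : free_group n) : seq (option 'I_n) :=
  flatten [seq if x.2 then [:: None; Some x.1] else [:: Some x.1; None]
          | x <- free_word g].

(** The group $W$ is not constructed: an identity in it becomes one for all families [t] of
    involutions in all groups [H]. *)
Definition word_prod (H : groupType) (t : option 'I_n -> H) w : H :=
  foldr (fun c a => t c * a)%g 1%g w.

Definition involution_lift (H : groupType) (t : option 'I_n -> H) :
    free_group n -> H :=
  free_lift (fun i => (t (Some i) * t None)%g).

Lemma word_prod_cat (H : groupType) (t : option 'I_n -> H) v w :
  word_prod t (v ++ w) = (word_prod t v * word_prod t w)%g.
Proof. by elim: v => [|c v IH] /=; rewrite ?mul1g// IH mulgA. Qed.

(** A letter put in front of [v] either cancels its first letter or extends it. The choice of [v]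
    precedes [t], because [t] will later be the action on the path labelled by [v]. *)
Lemma word_prod_path_word w : exists2 v, path_word v &
  forall (H : groupType) (t : option 'I_n -> H),
    (forall c, t c * t c = 1)%g -> word_prod t w = word_prod t v.
Proof.
elim: w => [|c w [v pv IH]]; first by exists [::].
case: v pv IH => [|d v] pv IH.
  by exists [:: c] => // H t tt /=; rewrite IH.
have [cd|cd] := eqVneq c d.
  exists v; first exact: path_sorted pv.
  by move=> H t tt /=; rewrite IH// /= cd mulgA tt mul1g.
exists [:: c, d & v]; first by rewrite /path_word /= cd.
by move=> H t tt /=; rewrite IH.
Qed.

Lemma involution_liftE (H : groupType) (t : option 'I_n -> H) :
  (forall c, t c * t c = 1)%g ->
  involution_lift t =1 word_prod t \o involution_word.
Proof.
move=> tt g; have tV c : ((t c)^-1 = t c)%g by apply: (mulgI (t c)); rewrite mulgV tt.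
rewrite /involution_lift /free_lift /involution_word /=.
elim: (free_word g) => [//|[i b] w IH] /=; rewrite word_prod_cat -IH.
by case: b => /=; rewrite ?invgM ?tV ?mulg1 // !mulgA.
Qed.

(* [letter_elt c] is the element t_c t_None of the free group, see
   [involution_lift_letters]. *)
Definition letter_elt c : free_group n :=
  if c is Some i then free_gen i else 1%g.

Lemma involution_liftM (H : groupType) (t : option 'I_n -> H) :
  {morph involution_lift t : g h / g * h}%g.
Proof. exact: free_liftM. Qed.

Lemma involution_liftV (H : groupType) (t : option 'I_n -> H) g :
  (involution_lift t g^-1 = (involution_lift t g)^-1)%g.
Proof.
apply: (mulIg (involution_lift t g)).
by rewrite -involution_liftM !mulVg.
Qed.

Lemma involution_lift_letters (H : groupType) (t : option 'I_n -> H) c d :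
  (forall c, t c * t c = 1)%g ->
  (involution_lift t (letter_elt c * (letter_elt d)^-1) = t c * t d)%g.
Proof.
move=> tt; have tV e : ((t e)^-1 = t e)%g by apply: (mulgI (t e)); rewrite mulgV tt.
have E e : (involution_lift t (letter_elt e) = t e * t None)%g.
  by case: e => [i|] /=; rewrite ?tt// /involution_lift free_lift_gen.
by rewrite involution_liftM involution_liftV !E invgM !tV -mulgA (mulgA (t None)) tt mul1g.
Qed.


(** This is conjugation by $y$ in $W$: $y(x_iy)y=yx_i=(x_iy)^{-1}$. *)
Definition gen_inversion : free_group n -> free_group n :=
  free_lift (fun i => (free_gen i)^-1)%g.

Lemma gen_inversionM : {morph gen_inversion : g h / g * h}%g.
Proof. exact: free_liftM. Qed.

Lemma gen_inversion_gen i : gen_inversion (free_gen i) = ((free_gen i)^-1)%g.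
Proof. exact: free_lift_gen. Qed.

Lemma gen_inversionV : {morph gen_inversion : g / g^-1}%g.
Proof.
move=> g; apply: (mulIg (gen_inversion g)).
by rewrite -gen_inversionM !mulVg.
Qed.

Lemma gen_inversionK : involutive gen_inversion.
Proof.
move=> g; have idE := @free_lift_unique n _ (@free_gen n) id.
rewrite [RHS](idE _ _ g)//; apply: (@free_lift_unique n _ _ (gen_inversion \o gen_inversion)) => [h k|i] /=.
  by rewrite !gen_inversionM.
by rewrite gen_inversion_gen gen_inversionV gen_inversion_gen invgK.
Qed.

(* W also acts on the free group itself: t_None inverts the generators and
   t_(Some i) t_None is left multiplication by the i-th generator. A word of
   involutions that reduces to the empty one therefore comes from 1. *)
Definition letter_involution c (g : free_group n) : free_group n :=
  (letter_elt c * gen_inversion g)%g.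

Lemma letter_involutionK c : involutive (letter_involution c).
Proof.
move=> g; rewrite /letter_involution gen_inversionM gen_inversionK mulgA.
case: c => [i|] /=; last by rewrite !mul1g.
by rewrite gen_inversion_gen mulgV mul1g.
Qed.

Definition letter_sym c : Sym (free_group n) :=
  MkSym (letter_involutionK c) (letter_involutionK c).

Lemma letter_sym_involution c : (letter_sym c * letter_sym c = 1)%g.
Proof. by apply/symP => g; exact: letter_involutionK. Qed.

(** Left translations form a homomorphism with the same values on the generators, so uniqueness of
    the lift applies. *)
Lemma involution_lift_letter_sym g h : involution_lift letter_sym g h = (g * h)%g.
Proof.
have mulK (a : free_group n) : cancel (fun h => a * h)%g (fun h => a^-1 * h)%g.
  exact: mulKg.
have mulVK (a : free_group n) : cancel (fun h => a^-1 * h)%g (fun h => a * h)%g.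
  exact: mulVKg.
pose L a : Sym (free_group n) := MkSym (mulK a) (mulVK a).
have LM : {morph L : a b / a * b}%g by move=> a b; apply/symP => k /=; rewrite mulgA.
have := @free_lift_unique n _ (fun i => letter_sym (Some i) * letter_sym None)%g L LM.
rewrite /involution_lift => <- // i; apply/symP => k /=.
by rewrite /letter_involution /= mul1g gen_inversionK.
Qed.

Lemma path_word_of_neq1 g : g <> 1%g ->
  exists v, [/\ path_word v, v != [::] &
    forall (H : groupType) (t : option 'I_n -> H),
      (forall c, t c * t c = 1)%g -> involution_lift t g = word_prod t v].
Proof.
move=> g1; have [v pv vE] := word_prod_path_word (involution_word g).
have gE (H : groupType) (t : option 'I_n -> H) :
    (forall c, t c * t c = 1)%g -> involution_lift t g = word_prod t v.
  by move=> tt; rewrite involution_liftE//= vE.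
exists v; split => //; apply: contra_notN g1 => /eqP v0.
(* Evaluation at 1 recovers [g] from its action. *)
rewrite -[g]mulg1 -involution_lift_letter_sym gE ?v0//.
exact: letter_sym_involution.
Qed.

End InvolutionWords.

(** * The action on a labelled path *)

Section PathAction.
Variables (n : nat) (v : seq (option 'I_n)).
Local Open Scope nat_scope.
Implicit Types (c d : option 'I_n) (j k : nat) (g : free_group n).

(** The edge from [j] to [j.+1] has label [onth v j], which is [None] past the end; thus the swap is
    defined on all of [nat] and fixes every number above [size v]. *)
Definition edge_swap c j : nat :=
  if onth v j == Some c then j.+1
  else if (0 < j) && (onth v j.-1 == Some c) then j.-1 else j.

Lemma onth_lt c j : onth v j = Some c -> j < size v.
Proof. by move=> vj; rewrite ltnNge; apply/negP => /onth_default; rewrite vj. Qed.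

Lemma edge_swap_le c j : j <= size v -> edge_swap c j <= size v.
Proof.
move=> jv; rewrite /edge_swap; case: eqP => [/onth_lt//|_].
by case: ifP => // _; exact: leq_trans (leq_pred _) jv.
Qed.

Lemma edge_swap_close c j : edge_swap c j <= j.+1 /\ j <= (edge_swap c j).+1.
Proof. by rewrite /edge_swap; case: ifP => _; [|case: ifP => _]; lia. Qed.

Lemma edge_swap_fix c j : onth v j <> Some c -> (0 < j -> onth v j.-1 <> Some c) ->
  edge_swap c j = j.
Proof.
move=> /eqP/negbTE h h'; rewrite /edge_swap h.
by case: ifP => // /andP[j0 /eqP] /(h' j0).
Qed.

Hypothesis pv : path_word v.

Lemma path_word_onth c j : onth v j = Some c -> onth v j.+1 <> Some c.
Proof.
move=> vj vj1; move: pv; rewrite /path_word => /(sortedP c)/(_ j (onth_lt vj1)).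
have nthE k : onth v k = Some c -> nth c v k = c.
  exact: onth_nth.
by rewrite !nthE// eqxx.
Qed.

(** Consecutive edges have distinct labels, so a point that has crossed an edge labelled [c] comes
    back across the same edge. *)
Lemma edge_swapK c : involutive (edge_swap c).
Proof.
move=> j; rewrite {2}/edge_swap; case: eqP => [vj|vj].
  rewrite /edge_swap /= vj eqxx; case: eqP => // vj1.
  by case: (path_word_onth vj).
case: ifP => [/andP[j0 vj1]|h]; last first.
  by apply: edge_swap_fix => // j0; move: h; rewrite j0 /= => /eqP.
by rewrite /edge_swap vj1 prednK.
Qed.

Definition swap_sym c : Sym nat := MkSym (edge_swapK c) (edge_swapK c).

Lemma swap_sym_involution c : (swap_sym c * swap_sym c = 1)%g.
Proof. by apply/symP => j; exact: edge_swapK. Qed.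

Definition path_action : free_group n -> Sym nat := involution_lift swap_sym.

Lemma path_actionM g h j : path_action (g * h)%g j = path_action g (path_action h j).
Proof. by rewrite /path_action involution_liftM. Qed.

Lemma path_action1 j : path_action 1%g j = j. Proof. by []. Qed.

Lemma path_actionK g : cancel (path_action g) (path_action g^-1%g).
Proof. by move=> j; rewrite -path_actionM mulVg. Qed.

Lemma path_action_le g j : j <= size v -> path_action g j <= size v.
Proof.
move=> jv; rewrite /path_action involution_liftE; last exact: swap_sym_involution.
rewrite /=; elim: (involution_word g) => //= c w IH.
exact: edge_swap_le.
Qed.

(** Each letter moves a point by at most one, whatever the path is. *)
Lemma path_action_close g j : path_action g j <= j + size (involution_word g)
  /\ j <= path_action g j + size (involution_word g).
Proof.
rewrite /path_action involution_liftE; last exact: swap_sym_involution.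
rewrite /=; elim: (involution_word g) => [|c w IH] /=; first by rewrite addn0.
have := edge_swap_close c (word_prod swap_sym w j); lia.
Qed.

Lemma path_action_next j : 1 < n -> j < size v ->
  exists c d, path_action (letter_elt c * (letter_elt d)^-1)%g j = j.+1.
Proof.
move=> n1 jv; have [c vj] : exists c, onth v j = Some c.
  by case E : (onth v j) => [c|]; [exists c|move: jv; rewrite -onthTE E].
(* The two edges at [j] use at most two of the [n.+1 > 2] labels. For [j = 0] both conditions
   concern the same edge. *)
have [d /andP[dj dj1]] : exists d, (onth v j != Some d) && (onth v j.-1 != Some d).
  apply/existsP; rewrite -[X in is_true X]negbK negb_exists; apply/negP => /forallP h.
  have : size (enum {: option 'I_n}) <= size (pmap id [:: onth v j; onth v j.-1]).
    apply: uniq_leq_size; first exact: enum_uniq.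
    move=> d _; move: (h d); rewrite negb_and !negbK mem_pmap map_id !inE.
    by case/orP => /eqP ->; apply/orP; [left|right]; exact/eqP.
  have -> : size (enum {: option 'I_n}) = n.+1 by rewrite -cardT card_option card_ord.
  rewrite size_pmap => /leq_trans/(_ (count_size _ _)) /=.
  lia.
exists c, d; rewrite /path_action involution_lift_letters /=; last first.
  exact: swap_sym_involution.
(* The letter [d] acts first and fixes [j]; then [c] crosses the edge. *)
rewrite (@edge_swap_fix d); first by rewrite /edge_swap vj eqxx.
  exact/eqP.
by move=> _; apply/eqP.
Qed.

Lemma path_action_transitive j : 1 < n -> j <= size v -> exists g, path_action g 0 = j.
Proof.
move=> n1; elim: j => [_|j IH jv]; first by exists 1%g.
have [g gj] := IH (ltnW jv).
have [c [d cd]] := path_action_next n1 jv.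
by exists (letter_elt c * (letter_elt d)^-1 * g)%g; rewrite path_actionM gj.
Qed.

Lemma word_prod_swap : word_prod swap_sym v (size v) = 0.
Proof.
(* The last letter acts first, so each suffix of [v] leads from the end of the path back across its
   own edges. *)
suff : forall w u, v = u ++ w -> word_prod swap_sym w (size v) = size u.
  by move=> /(_ v [::] erefl).
elim=> [u vu|c w IH u vu] /=; first by rewrite vu cats0.
rewrite (IH (rcons u c)) ?cat_rcons// size_rcons.
have uc : onth v (size u) = Some c by rewrite vu onth_cat ltnn subnn.
rewrite /edge_swap /= uc eqxx; case: eqP => // uc1.
by case: (path_word_onth uc).
Qed.

(** Since [g] already maps [size v] to 0, fixing 0 would force [size v = 0]. *)
Lemma path_action_neq0 g : v != [::] ->
  path_action g =1 word_prod swap_sym v -> path_action g 0 <> 0.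
Proof.
move=> v0 gv g0; have gs : path_action g (size v) = 0 by rewrite gv word_prod_swap.
move: v0; rewrite -size_eq0; apply/negP; rewrite negbK; apply/eqP.
by apply: (can_inj (path_actionK g)); rewrite g0.
Qed.

End PathAction.

(** * Schreier graphs of path stabilizers *)

Section PathRepresentation.
Variables (n : nat) (v : seq (option 'I_n)) (pv : path_word v).
Local Open Scope nat_scope.

Let stab1 : path_action pv 1%g 0 = 0. Proof. exact: path_action1. Qed.
Let stabM (g h : free_group n) : path_action pv g 0 = 0 -> path_action pv h 0 = 0 ->
  path_action pv (g * h)%g 0 = 0.
Proof. by move=> g0 h0; rewrite path_actionM h0. Qed.
Let stabV (g : free_group n) : path_action pv g 0 = 0 -> path_action pv g^-1%g 0 = 0.
Proof. by move=> g0; rewrite -{1}g0 path_actionK. Qed.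

Definition path_stabilizer : groupClosed (free_group n) :=
  subgroup_of (A := [set g | path_action pv g 0 = 0]) stab1 stabM stabV.

Lemma path_stabilizerE g : (g \in path_stabilizer) <-> path_action pv g 0 = 0.
Proof. exact: subgroup_ofE. Qed.

(** The orbit map at 0; by [coset_posE] it does not depend on the representative. *)
Definition coset_pos (z : cosets path_stabilizer) : nat :=
  path_action pv (coset_repr z) 0.

Lemma coset_posE g : coset_pos (coset_of_elt path_stabilizer g) = path_action pv g 0.
Proof.
have /coset_of_eltP/path_stabilizerE := coset_reprK (coset_of_elt path_stabilizer g).
rewrite path_actionM /coset_pos => /(congr1 (path_action pv (coset_repr (coset_of_elt path_stabilizer g)))).
by rewrite -path_actionM mulgV path_action1.
Qed.

Lemma coset_pos_inj : injective coset_pos.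
Proof.
move=> y z; rewrite -(coset_reprK y) -(coset_reprK z) !coset_posE => yz.
by apply/coset_of_eltP/path_stabilizerE; rewrite path_actionM -yz path_actionK.
Qed.

Lemma coset_pos_le z : coset_pos z <= size v.
Proof. exact: path_action_le. Qed.

Lemma coset_pos_surj j : 1 < n -> j <= size v -> exists z, coset_pos z = j.
Proof.
move=> n1 jv; have [g gj] := path_action_transitive pv n1 jv.
by exists (coset_of_elt path_stabilizer g); rewrite coset_posE.
Qed.

Lemma path_cosets_finite : finite_set [set: cosets path_stabilizer].
Proof.
suff -> : [set: cosets path_stabilizer] = coset_pos @^-1` `I_(size v).+1.
  by apply: finite_preimage => // x y _ _; exact: coset_pos_inj.
by apply/seteqP; split => z //= _; rewrite ltnS coset_pos_le.
Qed.

Definition path_symrep : irr_symrep (free_group n) := IrrSymRep path_cosets_finite.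

Lemma coset_pos_act g (z : symrep_space path_symrep) :
  coset_pos (symrep_hom path_symrep g z) = path_action pv g (coset_pos z).
Proof.
by rewrite -[z]coset_reprK coset_repE !coset_posE path_actionM.
Qed.

End PathRepresentation.

(** * A faithful sequence of path stabilizers *)

Definition path_words n : Type := {v : seq (option 'I_n) | path_word v}.
HB.instance Definition _ n := Countable.on (path_words n).

(** Numbers that code no path word yield the empty word, whose stabilizer is the whole group. *)
Definition path_words_enum n (k : nat) : path_words n :=
  odflt (exist _ [::] isT) (unpickle k).

Definition path_sequence n (k : nat) : irr_symrep (free_group n) :=
  path_symrep (valP (path_words_enum n k)).

(** An element other than 1 lies outside the stabilizer for the path labelled by its own normal form
    in $W$. *)
Lemma path_sequence_faithful n : faithful_sequence (@path_sequence n).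
Proof.
apply/seteqP; split => [g gN|_ -> k _]; last by apply/path_stabilizerE.
apply/not_notP => /path_word_of_neq1[v [pv v0 gv]].
pose w : path_words n := exist _ v pv.
have := gN (pickle w) I; rewrite /= /path_sequence /path_words_enum pickleK /=.
move=> /path_stabilizerE.
apply: path_action_neq0 => // j; rewrite /path_action gv//.
exact: swap_sym_involution.
Qed.

(** * Graph metric and position on the path *)

Section SchreierPosition.
Variables (n : nat) (S : set (free_group n)) (genS : generates S).
Local Open Scope nat_scope.

Lemma graph_dist_triangle (Gamma : connected_graph) (y x z : vertex Gamma) :
  graph_dist x z <= graph_dist x y + graph_dist y z.
Proof.
have [_] := graph_distP x z; apply.
exact: walk_cat (graph_distP x y).1 (graph_distP y z).1.
Qed.

Lemma graph_dist_sym (Gamma : connected_graph) (x y : vertex Gamma) :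
  graph_dist x y = graph_dist y x.
Proof.
have le (u t : vertex Gamma) : graph_dist u t <= graph_dist t u.
  by have [_] := graph_distP u t; apply; apply: walk_sym (graph_distP t u).1; exact: adj_sym.
by apply/eqP; rewrite eqn_leq !le.
Qed.

(** The elements with a displacement bound common to all representations form a subgroup that
    contains [T]. *)
Lemma schreier_displacement (G : groupType) (T : set G) (genT : generates T) (g : G) :
  exists k, forall (s : irr_symrep G) (z : vertex (schreier genT s)),
    graph_dist z (symrep_hom s g z : vertex (schreier genT s)) <= k.
Proof.
pose A : set G := fun g => exists k, forall (s : irr_symrep G) (z : vertex (schreier genT s)),
    graph_dist z (symrep_hom s g z : vertex (schreier genT s)) <= k.
have A1 : A 1%g.
  exists 0 => s z; rewrite gmulf1.
  by have [_ /(_ 0 erefl)] := graph_distP z z.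
have AM h k : A h -> A k -> A (h * k)%g.
  move=> [a Aa] [b Ab]; exists (a + b) => s z.
  rewrite gmulfM addnC.
  apply: leq_trans (graph_dist_triangle (symrep_hom s k z : vertex (schreier genT s)) _ _) _.
  by rewrite leq_add.
have AV h : A h -> A h^-1%g.
  move=> [a Aa]; exists a => s z.
  have := Aa s (symrep_hom s h^-1%g z); rewrite graph_dist_sym.
  suff -> : symrep_hom s h (symrep_hom s h^-1%g z) = z by [].
  by rewrite -[LHS]/((symrep_hom s h * symrep_hom s h^-1)%g z) -gmulfM mulgV gmulf1.
apply/(subgroup_ofE A1 AM AV); apply: (genT) => h Th.
apply/subgroup_ofE; exists 1 => s z.
have [_] := graph_distP z (symrep_hom s h z : vertex (schreier genT s)); apply.
by exists (symrep_hom s h z) => //; exists h => //; left.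
Qed.

Lemma graph_dist_lipschitz (Gamma : connected_graph) (f : vertex Gamma -> nat) C :
  (forall x y, adj x y -> f x <= f y + C) ->
  forall x y, f x <= f y + C * graph_dist x y.
Proof.
move=> fC x y; have [+ _] := graph_distP x y.
move: (graph_dist x y) => k; elim: k x => [x /= ->|k IH x /= [z xz /IH]].
  by rewrite muln0 addn0.
have := fC _ _ xz; lia.
Qed.

(** The constant is chosen before the path. One bound comes from the finitely many generators in
    [S], the other from the finitely many elements that advance a position by one. *)
Lemma path_schreier_quasi_isometry : finite_set S -> 1 < n ->
  exists C, forall (v : seq (option 'I_n)) (pv : path_word v)
      (y z : vertex (schreier genS (path_symrep pv))),
    coset_pos y <= coset_pos z + C * graph_dist y z /\
    graph_dist y z <= C * (coset_pos z - coset_pos y + (coset_pos y - coset_pos z)).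
Proof.
move=> finS n1.
have [C1 C1P] : exists C, forall g, S g -> size (involution_word g) <= C.
  have /finite_seqP[s sS] := finS.
  exists (\max_(g <- s) size (involution_word g)) => g; rewrite sS /= => gs.
  exact: leq_bigmax_seq.
have [K KP] := choice (@schreier_displacement _ _ genS).
(* By [path_action_next], one of these elements leads from any position to the next. *)
pose C2 := \max_(c : option 'I_n) \max_(d : option 'I_n) K (letter_elt c * (letter_elt d)^-1)%g.
exists (maxn C1 C2) => v pv y z; split.
  apply: (leq_trans (n := coset_pos z + C1 * graph_dist y z)); last first.
    by rewrite leq_add2l leq_mul2r leq_maxl orbT.
  apply: graph_dist_lipschitz => {z}y z [g /C1P gC].
  case=> ->; rewrite coset_pos_act.
    have [_] := path_action_close pv g (coset_pos y); lia.
  have [+ _] := path_action_close pv g (coset_pos z); lia.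
apply: (leq_trans (n := C2 * (coset_pos z - coset_pos y + (coset_pos y - coset_pos z)))); last first.
  by rewrite leq_mul2r leq_maxr orbT.
wlog yz : y z / coset_pos y <= coset_pos z.
  move=> H; have [/H//|/ltnW/H] := leqP (coset_pos y) (coset_pos z).
  by rewrite graph_dist_sym addnC.
have main k y' z' : coset_pos z' = coset_pos y' + k ->
    graph_dist (y' : vertex (schreier genS (path_symrep pv))) z' <= C2 * k.
  elim: k y' => [|k IH] y' yz'.
    have -> : y' = z' by apply: coset_pos_inj; rewrite yz' addn0.
    by have [_ /(_ 0 erefl)] := graph_distP (z' : vertex (schreier genS (path_symrep pv))) z'; rewrite muln0.
  have yv : coset_pos y' < size v by have := coset_pos_le z'; lia.
  have [c [d cd]] := path_action_next pv n1 yv.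
  set g := (letter_elt c * _)%g in cd.
  apply: leq_trans (graph_dist_triangle (symrep_hom (path_symrep pv) g y' : vertex (schreier genS _)) _ _) _.
  rewrite mulnS leq_add//.
    apply: leq_trans (KP _ _ _) _.
    by apply: leq_trans (leq_bigmax c); apply: (leq_bigmax d).
  by apply: IH; rewrite coset_pos_act cd yz' addnS.
(* By definition of [leq], [yz] says that the second truncated difference is 0. *)
by rewrite (eqP yz) addn0; apply: main; rewrite subnKC.
Qed.

End SchreierPosition.

(** * Property (A) *)

Section UniformVectors.
Variables (R : realType) (X : metricType R).
Implicit Types s t : seq X.

Lemma esum_indicator s (a : R) : uniq s -> 0 <= a ->
  (\esum_(x in [set: X]) (if x \in s then a else 0)%:E = ((size s)%:R * a)%:E)%E.
Proof.
move=> us a0; transitivity (\esum_(x in [set` s]) a%:E)%E.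
  rewrite [RHS]esum_mkcond; apply: eq_esum => x _.
  by rewrite mem_setE; case: ifP.
rewrite esum_fset//= -fsbig_seq// sumEFin big_const_seq count_predT.
by rewrite iter_addr_0 mulr_natl.
Qed.

Definition uniform_fun s (x : X) : R[i] :=
  Complex (if x \in s then (Num.sqrt (size s)%:R)^-1 else 0) 0.

Lemma normc_uniform_fun s x : Normc.normc (uniform_fun s x) ^+ 2 =
  if x \in s then (size s)%:R^-1 else 0.
Proof.
rewrite /uniform_fun /Normc.normc expr0n addr0 sqrtr_sqr real_normK ?num_real//.
by case: ifP => _; rewrite ?expr0n// exprVn sqr_sqrtr.
Qed.

Lemma uniform_fun_summable s : uniq s -> square_summable (uniform_fun s).
Proof.
move=> us; rewrite /square_summable.
under eq_esum do rewrite normc_uniform_fun.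
by rewrite esum_indicator ?ltry// invr_ge0.
Qed.

Definition uniform_vector s (us : uniq s) : ell2 X := Ell2 (uniform_fun_summable us).

Lemma uniform_vector_norm s (us : uniq s) : s != [::] ->
  ell2_norm (uniform_vector us) = 1.
Proof.
move=> s0; rewrite /ell2_norm /=.
under eq_esum do rewrite normc_uniform_fun.
rewrite esum_indicator ?invr_ge0//= mulfV ?sqrtr1//.
by rewrite pnatr_eq0 size_eq0.
Qed.

(** For equal sizes the two normalizing factors multiply to $1/|s|$ on the common points. *)
Lemma uniform_vector_dot s t (us : uniq s) (ut : uniq t) : size s = size t ->
  ell2_dot (uniform_vector us) (uniform_vector ut) =
  Complex ((count (mem t) s)%:R / (size s)%:R) 0.
Proof.
move=> st; rewrite /ell2_dot.
have E x : uniform_fun s x * conjc (uniform_fun t x) =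
    Complex (if x \in [seq y <- s | y \in t] then (size s)%:R^-1 else 0) 0.
  rewrite /uniform_fun mem_filter -st; apply/eqP; rewrite eq_complex /=.
  rewrite !(mul0r, mulr0, oppr0, subr0, addr0) eqxx andbT.
  case: (x \in s); case: (x \in t); rewrite ?(mul0r, mulr0)//=.
  by rewrite -invfM -expr2 sqr_sqrtr.
rewrite (funext E) /complex_sum /=.
have h x : 0 <= (if x \in [seq y <- s | y \in t] then (size s)%:R^-1 else 0 : R).
  by case: ifP => // _; rewrite invr_ge0.
congr Complex; rewrite /real_sum.
  rewrite [X in fine X - _](_ : _ = ((count (mem t) s)%:R / (size s)%:R)%:E); last first.
    rewrite -size_filter -esum_indicator ?filter_uniq ?invr_ge0//.
    by apply: eq_esum => x _; congr _%:E; apply/max_idPl.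
  rewrite [X in _ - fine X](_ : _ = 0%E) ?subr0//.
  by rewrite esum1// => x _; congr _%:E; apply/max_idPr; rewrite oppr_le0.
rewrite !esum1/= ?subr0// => x _; rewrite ?oppr0; congr _%:E; exact: maxxx.
Qed.

(** The normalized indicators of the sets [A x] serve as vectors: for close points the overlap ratio
    lies between $1-e$ and 1. *)
Lemma property_A_of_folner : bounded_geometry X ->
  (forall r e : R, 0 < r -> 0 < e -> exists (M : R) (A : X -> seq X),
    [/\ 0 < M, forall x, uniq (A x) /\ A x != [::],
        forall x y, y \in A x -> mdist x y < M
      & forall x y, mdist x y <= r -> size (A x) = size (A y) /\
          (1 - e) * (size (A x))%:R <= (count (mem (A y)) (A x))%:R]) ->
  property_A X.
Proof.
move=> bg folner; split => //.
  (* The closed unit ball is finite, so removing from the space its points other than [x] leaves a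
     neighbourhood of [x]. *)
  move=> x; have [C /(_ x) fC] := bg 1 ltr01.
  have fin : finite_set [set y : X | mdist x y <= 1] by apply/finite_set_leP; exists C.
  have cl : closed ([set y : X | mdist x y <= 1] `\ x).
    apply: (accessible_finite_set_closed.1 _); last exact: finite_setD.
    exact/hausdorff_accessible/metric_hausdorff.
  rewrite openE => _ ->; rewrite /interior.
  have nx : nbhs x (~` ([set y : X | mdist x y <= 1] `\ x)).
    by apply: open_nbhs_nbhs; split; [exact: closed_openC|case=> _; exact].
  apply: filterS (filterI (nbhsx_ballx x 1 ltr01) nx) => y.
  by rewrite ballEmdist /= => -[/ltW xy] /not_andP[//|/contrapT].
move=> r e r0 e0; have [M [A [M0 uA AM Ar]]] := folner r e r0 e0.
exists M, (fun x => uniform_vector (uA x).1); split => //.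
- by move=> x; rewrite uniform_vector_norm// (uA x).2.
- move=> x1 x2 /Ar [sA cA]; rewrite uniform_vector_dot//.
  have s0 : 0 < (size (A x1))%:R :> R.
    by rewrite ltr0n lt0n size_eq0 (uA x1).2.
  rewrite /Normc.normc /= oppr0 addr0 expr0n addr0 sqrtr_sqr ler_norml.
  rewrite lerBlDr lerBrDl.
  have c1 : (count (mem (A x2)) (A x1))%:R / (size (A x1))%:R <= 1 :> R.
    by rewrite ler_pdivrMr// mul1r ler_nat count_size.
  have : 1 - e <= (count (mem (A x2)) (A x1))%:R / (size (A x1))%:R :> R.
    by rewrite ler_pdivlMr.
  lra.
- move=> x y; rewrite ballEmdist /= /uniform_fun => h; apply: AM.
  by move: h; case: ifP => //; rewrite eqxx.
Qed.

End UniformVectors.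

Lemma exists_nat_ge (R : realType) (a : R) : exists m : nat, a <= m%:R.
Proof.
exists (Num.Def.archi_bound `|a|); apply: le_trans (ler_norm a) _.
exact/ltW/archi_boundP.
Qed.

Lemma card_le_seq (T : choiceType) (A : set T) (s : seq T) :
  (forall x, A x -> x \in s) -> (A #<= `I_(size s))%card.
Proof.
case: s => [|a s] As.
  by rewrite (_ : A = set0) ?card_ge0//; apply/seteqP; split => // x /As.
apply: card_le_trans (card_image_le (nth a (a :: s)) _).
apply: subset_card_le => x /As xs; exists (index x (a :: s)); last exact: nth_index.
by move: xs; rewrite -index_mem.
Qed.

(** The common indices form a block that starts at [maxn i j] and has length $c-|i-j|$, truncated at
    0. *)
Lemma count_overlapping_blocks (T : eqType) (f : nat -> T) (i j c : nat) :
  {in [pred k | (k < maxn i j + c)%N] &, injective f} ->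
  (c <= count (mem (map f (iota j c))) (map f (iota i c)) + (i - j + (j - i)))%N.
Proof.
move=> finj; rewrite addnC -leq_subLR -size_filter.
set d := (_ + _)%N; rewrite -[X in (X <= _)%N](size_iota (maxn i j)) -(size_map f).
apply: uniq_leq_size.
  rewrite map_inj_in_uniq ?iota_uniq// => k l; rewrite !mem_iota => kI lI.
  by apply: finj; rewrite !inE /=; lia.
move=> _ /mapP[k + ->]; rewrite mem_iota mem_filter => kI.
by apply/andP; split; apply: map_f; rewrite mem_iota; lia.
Qed.

(** * Unions of uniformly distorted intervals *)

Section IntervalUnion.
Variables (R : realType) (X : metricType R) (p : X -> nat).
Variables (L : nat -> nat) (psi : nat -> nat -> X) (C : nat).
Hypothesis psi_onto : forall x, exists2 j, (j <= L (p x))%N & psi (p x) j = x.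
Hypothesis psi_lower : forall n j k, (j <= L n)%N -> (k <= L n)%N ->
  j%:R <= k%:R + C%:R * mdist (psi n j) (psi n k).
Hypothesis psi_upper : forall n j k, (j <= L n)%N -> (k <= L n)%N ->
  mdist (psi n j) (psi n k) <= C%:R * (k - j + (j - k))%:R.
Hypothesis p_far : forall r : R, exists K, forall x y, mdist x y <= r ->
  p x = p y \/ (p x <= K)%N /\ (p y <= K)%N.

Let pos (x : X) : nat := s2val (cid2 (psi_onto x)).
Let pos_le x : (pos x <= L (p x))%N. Proof. exact: s2valP (cid2 (psi_onto x)). Qed.
Let posK x : psi (p x) (pos x) = x. Proof. exact: s2valP' (cid2 (psi_onto x)). Qed.

Let psi_inj n : {in [pred j | (j < (L n).+1)%N] &, injective (psi n)}.
Proof.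
move=> j k; rewrite !inE !ltnS => jL kL e.
have := psi_lower jL kL; have := psi_lower kL jL.
rewrite e mdistxx mulr0 !addr0 !ler_nat => kj jk.
by apply/eqP; rewrite eqn_leq jk kj.
Qed.

Let pos_close (r : R) (m : nat) x y : C%:R * r <= m%:R -> p x = p y -> mdist x y <= r ->
  (pos x <= pos y + m)%N /\ (pos y <= pos x + m)%N.
Proof.
move=> rm xy dr; have xL := pos_le x; have yL := pos_le y.
rewrite -xy in yL; have := psi_lower xL yL; have := psi_lower yL xL.
rewrite posK xy posK (metric_sym y) -!(ler_nat R) !natrD.
have : C%:R * mdist x y <= m%:R by apply: le_trans rm; rewrite ler_wpM2l.
lra.
Qed.

Let low (K : nat) : seq X :=
  [seq psi n j | n <- iota 0 K.+1, j <- iota 0 (L n).+1].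

Let mem_low K x : (p x <= K)%N -> x \in low K.
Proof.
move=> xK; apply/allpairsPdep; exists (p x), (pos x).
by rewrite !mem_iota !add0n !ltnS xK pos_le posK.
Qed.

(** An $r$-ball lies in the low levels together with a window of positions. Truncation in
    [pos x - m] only shifts the window upwards, and it still reaches [pos x + m]. *)
Let interval_union_bounded_geometry : bounded_geometry X.
Proof.
move=> r r0; have [K farK] := p_far r; have [m rm] := exists_nat_ge (C%:R * r).
exists (size (low K) + m.*2.+1)%N => x.
pose s := low K ++ [seq psi (p x) j | j <- iota (pos x - m) m.*2.+1].
have -> : (size (low K) + m.*2.+1)%N = size s by rewrite /s size_cat size_map size_iota.
apply: card_le_seq => y /= dr; rewrite mem_cat; apply/orP.
have [xy|[_ /mem_low]] := farK _ _ dr; [right|by left].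
have [h h'] := pos_close rm xy dr.
by apply/mapP; exists (pos y); rewrite ?xy ?posK// mem_iota; lia.
Qed.

Lemma interval_union_property_A : property_A X.
Proof.
apply: property_A_of_folner => // r e r0 e0.
have [K farK] := p_far r; have [m rm] := exists_nat_ge (C%:R * r).
(* A shift by [m] loses at most [m] of the [k] points of a block; $k\ge m/e$ makes this at most the
   proportion $e$. *)
have [k' mk'] := exists_nat_ge (m%:R / e); pose k := k'.+1.
have mk : m%:R <= e * k%:R.
  rewrite mulrC -ler_pdivrMr//; apply: le_trans mk' _; by rewrite ler_nat.
(* The block starts at [pos x], or earlier if it would overrun the end; an interval with fewer than
   [k] points is its own block. *)
pose len x := minn k (L (p x)).+1; pose start x := minn (pos x) ((L (p x)).+1 - len x).
have block x : [/\ (0 < len x <= k)%N, (start x <= pos x < start x + len x)%N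
    & (start x + len x <= (L (p x)).+1)%N].
  by have := pos_le x; rewrite /start /len; split; lia.
pose A x := if (p x <= K)%N then [:: psi 0 0] else map (psi (p x)) (iota (start x) (len x)).
(* The 1 makes the inequality strict, the product covers a block, and the sum covers the distances
   from the low levels to [psi 0 0]. *)
exists (1 + C%:R * k%:R + \sum_(y <- low K) mdist y (psi 0 0)), A; split.
- rewrite -addrA ltr_pwDl// addr_ge0 ?mulr_ge0// sumr_ge0// => y _.
  exact: mdist_ge0.
- move=> x; have [] := block x; rewrite /A; case: ifP => // _ *; split.
    rewrite map_inj_in_uniq ?iota_uniq// => i j; rewrite !mem_iota => iI jI.
    by apply: psi_inj; rewrite inE /=; lia.
  by rewrite -size_eq0 size_map size_iota; lia.
- move=> x y; rewrite /A; case: ifP => xK.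
    rewrite inE => /eqP ->; rewrite (big_rem x) ?mem_low//=.
    have : 0 <= \sum_(y <- rem x (low K)) mdist y (psi 0 0).
      by rewrite sumr_ge0// => z _; exact: mdist_ge0.
    have : 0 <= C%:R * k%:R :> R by rewrite mulr_ge0.
    lra.
  move=> /mapP[j + ->]; rewrite mem_iota => jI; have xL := pos_le x; have [] := block x => *.
  have jL : (j <= L (p x))%N by lia.
  have := psi_upper xL jL; rewrite posK.
  have : C%:R * (j - pos x + (pos x - j))%:R <= C%:R * k%:R :> R.
    by rewrite ler_wpM2l// ler_nat; lia.
  have : 0 <= \sum_(y <- low K) mdist y (psi 0 0).
    by rewrite sumr_ge0// => z _; exact: mdist_ge0.
  lra.
(* Close points of different levels both have level at most [K], where [A] is constant. *)
move=> x y dr; rewrite /A; have [xy|[-> ->]] := farK _ _ dr; last first.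
  by rewrite /= inE eqxx mulr1 addn0; split; rewrite // gerBl ltW.
rewrite -xy; case: ifP => [_|_]; first by rewrite /= inE eqxx mulr1 addn0; split; rewrite // gerBl ltW.
have lxy : len x = len y by rewrite /len xy.
rewrite !size_map !size_iota -lxy; split => //.
have [h h'] := pos_close rm xy dr.
have := @count_overlapping_blocks X (psi (p x)) (start x) (start y) (len x).
set c := count _ _ => /(_ _) cI.
have [_ _ bx] := block x; have [_ _ byy] := block y; rewrite -xy -lxy in byy.
have {}cI : (len x <= c + (start x - start y + (start y - start x)))%N.
  by apply: cI => i j; rewrite !inE => iI jI; apply: psi_inj; rewrite inE /=; lia.
(* With at least [k] points in the interval, the starts differ by at most [m], as a minimum with a
   constant is 1-Lipschitz; otherwise both blocks are the whole interval. *)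
have [kL|Lk] := leqP k (L (p x)).+1.
  have lk : len x = k by rewrite /len; lia.
  have : (len x <= c + m)%N by rewrite /start -xy -lxy in cI; lia.
  rewrite -(ler_nat R) natrD lk; lra.
have lL : len x = (L (p x)).+1 by rewrite /len; lia.
have : (len x <= c)%N by rewrite /start -xy -lxy in cI; lia.
rewrite -(ler_nat R); have : 0 <= e * (len x)%:R by rewrite mulr_ge0// ltW.
lra.
Qed.

End IntervalUnion.

(** * Levels of a coarse disjoint union *)

Lemma le_d_fa (R : realType) (n m : nat) : n <> m -> (maxn n m)%:R <= d_fa R n m.
Proof.
wlog nm : n m / (n < m)%N.
  move=> H nm; have [h|mn] : (n < m)%N \/ (m < n)%N by lia.
    exact: (H _ _ h).
  by rewrite maxnC /d_fa distrC; apply: (H _ _ mn); exact/nesym.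
move=> _; rewrite (maxn_idPr (ltnW nm)) /d_fa distrC; apply: le_trans (ler_norm _).
(* For $n<m$ one has $2^m-2^n\ge 2^{m-1}\ge m$. *)
rewrite lerBrDr -!natrX -natrD ler_nat; case: m nm => [//|m]; rewrite ltnS => nm.
rewrite expnS mul2n -addnn leq_add//; first exact: ltn_expl.
by rewrite leq_exp2l.
Qed.

(** Distinct levels at distance at most [r] satisfy [d_fa <= rho r], and [le_d_fa] then bounds both
    indices. *)
Lemma d_fa_far (R : realType) (X : metricType R) (p : X -> nat) (rho : R -> R) :
  (forall t u, 0 <= t -> t <= u -> rho t <= rho u) ->
  (forall x y, d_fa R (p x) (p y) <= rho (mdist x y)) ->
  forall r : R, exists K, forall x y, mdist x y <= r ->
    p x = p y \/ (p x <= K)%N /\ (p y <= K)%N.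
Proof.
move=> rho_mono p_rho r; have [K rK] := exists_nat_ge (rho r).
exists K => x y dr; have [|/eqP pxy] := eqVneq (p x) (p y); [by left|right].
apply/andP; rewrite -geq_max -(ler_nat R).
apply: le_trans (le_d_fa R pxy) _; apply: le_trans (p_rho _ _) _.
by apply: le_trans rK; apply: rho_mono => //; exact: mdist_ge0.
Qed.

Theorem proposition2 (R : realType) (S : set F2)
    (finS : finite_set S) (genS : generates S) :
  exists sigma : nat -> irr_symrep F2,
    faithful_sequence sigma /\
    forall X : metricType R,
      is_coarse_disjoint_union
        (fun n => graph_space R (schreier genS (sigma n)) : metricType R) X ->
      property_A X.
Proof.
exists (@path_sequence 2); split; first exact: path_sequence_faithful.
move=> X [p [rho [[_ rho_mono _] iso p_rho _]]].
have [C CP] := path_schreier_quasi_isometry genS finS (ltnSn 1).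
pose L k := size (val (path_words_enum 2 k)).
pose Y k := graph_space R (schreier genS (path_sequence 2 k)).
(* The bound on [j] stands under the quantifier so that choice gives a total map [q]; past the end
   its value is the coset of 1 or any other. *)
have point k j : exists z : Y k, (j <= L k)%N ->
    coset_pos (z : cosets (path_stabilizer (valP (path_words_enum 2 k)))) = j.
  have [jL|jL] := leqP j (L k).
    have [z zj] := coset_pos_surj (valP (path_words_enum 2 k)) (ltnSn 1) jL.
    by exists z.
  by exists (coset_of_elt _ 1%g).
pose q k j := projT1 (cid (point k j)).
have qP k j : (j <= L k)%N -> coset_pos (q k j) = j := projT2 (cid (point k j)).
have iX k : exists2 i : Y k -> X, (forall y z, mdist (i y) (i z) = mdist y z) &
    range i = p @^-1` [set k] := iso k.
pose i k := s2val (cid2 (iX k)).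
have idist k y z : mdist (i k y) (i k z) = mdist y z by exact: (s2valP (cid2 (iX k))).
have irange k : range (i k) = p @^-1` [set k] by exact: (s2valP' (cid2 (iX k))).
apply: (@interval_union_property_A R X p L (fun k j => i k (q k j)) C).
(* The coset behind [x] is recovered by [q] from its position, since [coset_pos] is injective. *)
- move=> x; have : range (i (p x)) x by rewrite irange.
  move=> [z _ zx]; exists (coset_pos z); first exact: coset_pos_le.
  rewrite -[in RHS]zx; congr i; apply: coset_pos_inj; rewrite qP//.
  exact: coset_pos_le.
- move=> k j l jL lL; rewrite idist graph_mdistE -natrM -natrD ler_nat.
  have [+ _] := CP _ (valP (path_words_enum 2 k)) (q k j) (q k l).
  by rewrite !qP.
- move=> k j l jL lL; rewrite idist graph_mdistE -natrM ler_nat.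
  have [_] := CP _ (valP (path_words_enum 2 k)) (q k j) (q k l).
  by rewrite !qP.
exact: d_fa_far rho_mono p_rho.
Qed.
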